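(* Let $\Omega=\{1,\dots,d\}^{\mathbb N}$ with the shift $\sigma$, let $A:\Omega\to\mathbb R$ be Lipschitz continuous, let $h$ be the Peierls barrier of $A$, and let $u:\Omega\to\mathbb R$ be any calibrated subaction for $A$. If $x$ and $z$ are in the same irreducible component of the Aubry set $\mathcal A$, then for any $y\in\Omega$, $$h(x,y)+u(x)=h(z,y)+u(z).$$
   Context: $\Omega$ carries the metric $d(x,y)=2^{-\min\{n:\ x_n\ne y_n\}}$ and $\sigma(x_0x_1x_2\ldots)=x_1x_2\ldots$. $m(A)=\max\int A\,d\nu$ over $\sigma$-invariant Borel probability measures $\nu$. $S_n(f)=f+f\circ\sigma+\dots+f\circ\sigma^{n-1}$. The Peierls barrier is $$h(x,y)=\lim_{\epsilon\to0}\ \limsup_{n\to\infty}\ \sup\{S_n(A-m(A))(z):\ z\in\Omega,\ \sigma^n(z)=y,\ d(x,z)<\epsilon\}\in[-\infty,+\infty).$$ The Mañé potential is $S_A(x,y)=\lim_{\epsilon\to0}\sup\{S_n(A-m(A))(z):\ n\ge1,\ \sigma^n(z)=y,\ d(z,x)<\epsilon\}$, and the Aubry set is $\mathcal A=\{x\in\Omega:\ S_A(x,x)=0\}$. The relation $h(x,y)+h(y,x)=0$ is an equivalence relation on $\mathcal A$; its classes are the irreducible components of $\mathcal A$. A calibrated subaction is a continuous $u:\Omega\to\mathbb R$ with $u(x)=\max_{\sigma(y)=x}[A(y)+u(y)-m(A)]$ for all $x\in\Omega$. *)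

(* Defs.v *)
From HB Require Import structures.
From mathcomp Require Import all_boot all_order all_algebra.
From mathcomp Require Import all_classical all_reals all_analysis.

Set Implicit Arguments.
Unset Strict Implicit.
Unset Printing Implicit Defensive.

Import Order.TTheory GRing.Theory Num.Theory.
Import numFieldNormedType.Exports.

Local Open Scope classical_set_scope.
Local Open Scope ring_scope.

(* The full shift on d.+1 symbols, i.e. at least one symbol. The field R is a
   phantom parameter: the distance below is R-valued, so R has to be
   recoverable from the type. *)
Definition full_shift (R : realType) (d : nat) : Type := nat -> 'I_d.+1.

HB.instance Definition _ (R : realType) (d : nat) :=
  Choice.copy (full_shift R d) (nat -> 'I_d.+1).
HB.instance Definition _ (R : realType) (d : nat) :=
  isPointed.Build (full_shift R d) (fun=> ord0).

Section shift_metric.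
Context {R : realType} {d : nat}.
Implicit Types x y z : full_shift R d.

Definition shift_dist x y : R :=
  if pselect (exists n, x n != y n) is left xy then 2^-1 ^+ ex_minn xy else 0.

Variant shift_dist_spec x y : R -> Type :=
| ShiftDistEq of x = y : shift_dist_spec x y 0
| ShiftDistNeq n of x n != y n & (forall k, (k < n)%N -> x k = y k) :
    shift_dist_spec x y (2^-1 ^+ n).

Lemma shift_distP x y : shift_dist_spec x y (shift_dist x y).
Proof.
rewrite /shift_dist; case: pselect => [xy|xy].
  case: ex_minnP => n xyn min_n; constructor => // k kn.
  by apply/eqP; apply: contraTT kn => /min_n; rewrite -leqNgt.
by constructor; apply/funext => n; apply: contra_notP xy => /eqP ?; exists n.
Qed.

Lemma shift_dist_ge0 x y : 0 <= shift_dist x y.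
Proof. by case: shift_distP => // n _ _; rewrite exprn_ge0// invr_ge0. Qed.

Lemma shift_distxx x : shift_dist x x = 0.
Proof. by case: shift_distP => // n; rewrite eqxx. Qed.

Lemma shift_dist_positivity x y : shift_dist x y = 0 -> x = y.
Proof.
case: shift_distP => // n _ _ /eqP.
by rewrite expf_eq0 invr_eq0 (pnatr_eq0 R 2) andbF.
Qed.

Lemma shift_dist_le x y n :
  (forall k, (k < n)%N -> x k = y k) -> shift_dist x y <= 2^-1 ^+ n.
Proof.
move=> xy; case: shift_distP => [_|m xym _].
  by rewrite exprn_ge0// invr_ge0.
apply: ler_wiXn2l; rewrite ?invr_ge0 ?invf_le1 ?ler1n//.
by rewrite leqNgt; apply: contra xym => /xy ->.
Qed.

Lemma shift_dist_sym x y : shift_dist x y = shift_dist y x.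
Proof.
have le u v : shift_dist u v <= shift_dist v u.
  case: (shift_distP v u) => [->|n _ vu]; first by rewrite shift_distxx.
  by apply: shift_dist_le => k /vu.
by apply/eqP; rewrite eq_le !le.
Qed.

Lemma shift_dist_triangle y x z :
  shift_dist x z <= shift_dist x y + shift_dist y z.
Proof.
case: (shift_distP x z) => [_|n xzn _]; first by rewrite addr_ge0 ?shift_dist_ge0.
have le u v : u n != v n -> 2^-1 ^+ n <= shift_dist u v.
  case: (shift_distP u v) => [->|m _ uv uvn]; first by rewrite eqxx.
  apply: ler_wiXn2l; rewrite ?invr_ge0 ?invf_le1 ?ler1n//.
  by rewrite leqNgt; apply: contra uvn => /uv ->.
have [xy|xy] := eqVneq (x n) (y n).
  by rewrite (le_trans (le y z _)) ?lerDr ?shift_dist_ge0// -xy.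
by rewrite (le_trans (le x y xy)) ?lerDl ?shift_dist_ge0.
Qed.

End shift_metric.

HB.instance Definition _ (R : realType) (d : nat) :=
  isMetric.Build R (full_shift R d) shift_distxx shift_dist_positivity
    shift_dist_sym shift_dist_triangle.

(* the same space, with its Borel sigma-algebra *)
Definition borel_shift (R : realType) (d : nat) :=
  g_sigma_algebraType (@open (full_shift R d)).

Section ergodic_optimization.
Context {R : realType} {d : nat}.
Local Notation Omega := (full_shift R d).
Implicit Types (A u f : Omega -> R) (x y z w : Omega).

Definition shift x : Omega := fun n => x n.+1.

Definition lipschitz_fun A : Prop :=
  exists K : R, forall x y, `|A x - A y| <= K * mdist x y.

Definition shift_invariant (nu : probability (borel_shift R d) R) : Prop :=
  forall B : set (borel_shift R d), measurable B -> nu (shift @^-1` B) = nu B.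

(* For continuous A the supremum is attained (weak-* compactness), so it is
   the maximum. *)
Definition max_mean A : R :=
  sup [set \int[nu]_x A x |
       nu in [set nu : probability (borel_shift R d) R | shift_invariant nu]].

Definition birkhoff_sum (n : nat) f x : R := \sum_(i < n) f (iter i shift x).

Definition normalized A : Omega -> R := fun x => A x - max_mean A.

Definition peierls_barrier A x y : \bar R :=
  lim ((limn_esup (fun n : nat =>
    ereal_sup [set (birkhoff_sum n (normalized A) z)%:E |
               z in [set z | iter n shift z = y /\ mdist x z < e]]))
    @[e --> (0 : R)^'+]).

Definition mane_potential A x y : \bar R :=
  lim ((ereal_sup [set s | exists (n : nat) (z : Omega),
    [/\ (1 <= n)%N, iter n shift z = y, mdist z x < e
      & s = (birkhoff_sum n (normalized A) z)%:E]])
    @[e --> (0 : R)^'+]).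

Definition aubry_set A : set Omega := [set x | mane_potential A x x = 0%E].

Definition barrier_rel A x y : Prop :=
  (peierls_barrier A x y + peierls_barrier A y x = 0)%E.

(* the classes of barrier_rel A on aubry_set A *)
Definition irreducible_components A : set (set Omega) :=
  [set [set y | aubry_set A y /\ barrier_rel A w y] | w in aubry_set A].

Definition is_max (S : set R) (r : R) : Prop := S r /\ ubound S r.

Definition calibrated_subaction A u : Prop :=
  continuous u /\
  forall x, is_max [set A y + u y - max_mean A | y in [set y | shift y = x]]
                   (u x).

End ergodic_optimization.

(* Main.v *)
(** The Peierls barrier satisfies the reverse triangle inequality
    [h(x,w) + h(w,y) <= h(x,y)]: an orbit segment from near [x] to [w] can be
    prolonged by one from near [w] to [y], and the error made on the first
    segment is at most [K d(w,z)], [z] being the start of the second one,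
    because distances halve when orbits are followed backwards. On the other
    hand a subaction gives [h(x,y) <= u(y) - u(x)]. When
    [h(w,x) + h(x,w) = 0] both upper bounds are equalities, so the triangle
    inequalities through [w] and through [x] read
    [h(x,y) + u(x) >= h(w,y) + u(w)] and conversely. *)

Require Import Defs.
From HB Require Import structures.
From mathcomp Require Import all_boot all_order all_algebra.
From mathcomp Require Import all_classical all_reals all_analysis.
From mathcomp Require Import lra.

Set Implicit Arguments.
Unset Strict Implicit.
Unset Printing Implicit Defensive.

Import Order.TTheory GRing.Theory Num.Theory.
Import numFieldNormedType.Exports.

Local Open Scope classical_set_scope.
Local Open Scope ring_scope.

(* [all_analysis] shadows the shift map. *)
Local Notation shift := Defs.shift.

(** * Extended reals and limits superior *)

Section ereal_extra.
Context {R : realType}.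
Implicit Types a b c : \bar R.

Lemma lee_EFin_lt a b : (forall r : R, r%:E < a -> r%:E <= b)%E -> (a <= b)%E.
Proof.
case: a => [a| |] ab; last by rewrite leNye.
  apply/lee_subgt0Pr => e e0; rewrite -EFinB; apply: ab.
  by rewrite lte_fin ltrBlDr ltrDl.
suff -> : b = +oo%E by [].
by apply/eqyP => r _; apply: ab; rewrite ltry.
Qed.

(** Reduces bounds on sums of barriers to real Birkhoff sums. If [a] or [b] is [-oo], so is the
    sum. *)
Lemma leeD_EFin_lt a b c :
  (forall r s : R, r%:E < a -> s%:E < b -> (r + s)%:E <= c)%E ->
  (a + b <= c)%E.
Proof.
case: a b => [a| |] [b| |] abc; rewrite ?addeNy ?addNye ?leNye//;
  apply: lee_EFin_lt => r rab.
- have {}rab : r < a + b by rewrite -lte_fin.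
  (* Each summand gives up half of the gap [a + b - r]. *)
  rewrite (_ : r = a - (a + b - r) / 2 + (b - (a + b - r) / 2)); last by lra.
  by apply: abc; rewrite lte_fin; lra.
- by rewrite -(subrKC (a - 1) r); apply: abc; rewrite ?ltry// lte_fin; lra.
- by rewrite -(subrK (b - 1) r); apply: abc; rewrite ?ltry// lte_fin; lra.
- by rewrite -(subrK 0 r); apply: abc; rewrite ltry.
Qed.

Lemma limn_esup_gt_exists (v : (\bar R)^nat) a : (a < limn_esup v)%E ->
  forall N, exists2 n, (N <= n)%N & (a < v n)%E.
Proof.
move=> av N.
have /ereal_sup_gt[_ [n /= Nn <-] avn] :
    (a < ereal_sup (v @` [set n | (N <= n)%N]))%E.
  apply: lt_le_trans av _; apply: ereal_inf_lbound.
  by exists [set n | (N <= n)%N] => //; exists N.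
by exists n.
Qed.

Lemma limn_esup_ge (v : (\bar R)^nat) a :
  (forall N, exists2 n, (N <= n)%N & (a <= v n)%E) -> (a <= limn_esup v)%E.
Proof.
move=> av; apply: le_ereal_inf_tmp => _ [V [N _ NV] <-].
have [n Nn avn] := av N; apply: le_trans avn _.
by apply: ereal_sup_ubound; exists n => //; exact: NV.
Qed.

End ereal_extra.

(** * Birkhoff sums along orbits with a common prefix *)

Section birkhoff.
Context {R : realType} {d : nat}.
Local Notation Omega := (full_shift R d).
Implicit Types (A u f : Omega -> R) (x y z w : Omega).

Lemma iter_shiftE n x k : iter n shift x k = x (n + k)%N.
Proof. by elim: n k => //= n IH k; rewrite {1}/shift IH addnS. Qed.

Lemma birkhoff_sumD m n f x : birkhoff_sum (m + n) f x =
  birkhoff_sum m f x + birkhoff_sum n f (iter m shift x).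
Proof.
rewrite /birkhoff_sum big_split_ord /=; congr (_ + _).
by apply: eq_bigr => i _; rewrite addnC iterD.
Qed.

Lemma mdist_agree n x y : (forall k, (k < n)%N -> x k = y k) ->
  mdist x y <= 2^-1 ^+ n * mdist (iter n shift x) (iter n shift y).
Proof.
move=> xy; change (shift_dist x y <=
  2^-1 ^+ n * shift_dist (iter n shift x) (iter n shift y)).
case: (shift_distP (iter n shift x) (iter n shift y)) => [sxy|m _ sxy].
  suff -> : x = y by rewrite shift_distxx mulr0.
  apply/funext => k; have [/xy//|nk] := ltnP k n.
  by have := congr1 (fun s => s (k - n)%N) sxy; rewrite !iter_shiftE subnKC.
rewrite -exprD; apply: shift_dist_le => k kmn.
have [/xy//|nk] := ltnP k n.
have := sxy (k - n)%N; rewrite !iter_shiftE subnKC//; apply.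
by rewrite ltn_subLR.
Qed.

(** The bound does not grow with [n]: going backwards from time [n], the distances of the iterates
    are at most 1/2, 1/4, ... of the final one, and these factors sum to at most 1. *)
Lemma birkhoff_sum_lipschitz n f (K : R) x y : 0 <= K ->
  (forall s t, `|f s - f t| <= K * mdist s t) ->
  (forall k, (k < n)%N -> x k = y k) ->
  `|birkhoff_sum n f x - birkhoff_sum n f y| <=
    K * mdist (iter n shift x) (iter n shift y).
Proof.
move=> K0 fK; elim: n => [|n IH] xy.
  by rewrite /birkhoff_sum !big_ord0 subrr normr0 mulr_ge0// mdist_ge0.
have half : mdist (iter n shift x) (iter n shift y) <=
    2^-1 * mdist (iter n.+1 shift x) (iter n.+1 shift y).
  apply: (@mdist_agree 1) => -[|//] _.
  by rewrite !iter_shiftE addn0 xy.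
have := IH (fun k kn => xy k (ltnW kn)).
have := fK (iter n shift x) (iter n shift y).
have := ler_wpM2l K0 half.
rewrite /birkhoff_sum !big_ord_recr/= opprD addrACA => h1 h2 h3.
apply: le_trans (ler_normD _ _) _.
lra.
Qed.

(** The preimage of [y] under the inverse branch of the [n]-th iterate of the shift selected by the
    first [n] symbols of [x]. *)
Definition splice n x y : Omega :=
  fun k => if (k < n)%N then x k else y (k - n)%N.

Lemma iter_shift_splice n x y : iter n shift (splice n x y) = y.
Proof.
by apply/funext => k; rewrite iter_shiftE /splice ltnNge leq_addr addKn.
Qed.

Lemma spliceE n x y k : (k < n)%N -> x k = splice n x y k.
Proof. by rewrite /splice => ->. Qed.

End birkhoff.

(** * The Peierls barrier *)

Section barrier.
Context {R : realType} {d : nat}.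
Local Notation Omega := (full_shift R d).
Implicit Types (A u f : Omega -> R) (x y z w : Omega).

(** Shrinking [e] leaves fewer admissible [z], so the limit at [0] is that of a monotone
    function. *)
Lemma peierls_barrierE A x y : peierls_barrier A x y =
  ereal_inf [set limn_esup (fun n : nat =>
    ereal_sup [set (birkhoff_sum n (normalized A) z)%:E |
               z in [set z | iter n shift z = y /\ mdist x z < e]])
  | e in [set e : R | 0 < e]].
Proof.
rewrite /peierls_barrier; apply: cvg_lim => //.
set F := (X in X @ _).
have ndF : {in `]0, +oo[ &, nondecreasing_fun F}.
  move=> e1 e2 _ _ e12; apply: lee_EFin_lt => r rF.
  apply: limn_esup_ge => N; have [n Nn rn] := limn_esup_gt_exists rF N.
  exists n => //; apply: (le_trans (ltW rn)).
  apply: ereal_sup_le => _ [z [zy xz] <-].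
  by exists z => //; split=> //; apply: lt_le_trans xz e12.
have := nondecreasing_at_right_cvge +oo%O isT ndF.
rewrite (_ : [set` `]0, +oo[] = [set e : R | 0 < e])//.
by apply/seteqP; split=> e /=; rewrite in_itv/= andbT.
Qed.

Lemma peierls_barrier_gt A x y (r : R) : (r%:E < peierls_barrier A x y)%E ->
  forall (e : R) N, 0 < e -> exists n z, [/\ (N <= n)%N, iter n shift z = y,
    mdist x z < e & r < birkhoff_sum n (normalized A) z].
Proof.
rewrite peierls_barrierE => rh e N e0.
have e_pos : [set e : R | 0 < e] e by [].
have /limn_esup_gt_exists/(_ N)[n Nn /ereal_sup_gt[_ [z [zy xz] <-]]] :=
  lt_le_trans rh (ereal_inf_lbound (imageP _ e_pos)).
by rewrite lte_fin => rz; exists n, z.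
Qed.

Lemma peierls_barrier_ge A x y (r : R) :
  (forall (e : R) N, 0 < e -> exists n z, [/\ (N <= n)%N, iter n shift z = y,
    mdist x z < e & r <= birkhoff_sum n (normalized A) z]) ->
  (r%:E <= peierls_barrier A x y)%E.
Proof.
rewrite peierls_barrierE => H; apply: le_ereal_inf_tmp => _ [e /= e0 <-].
apply: limn_esup_ge => N; have [n [z [Nn zy xz rz]]] := H e N e0.
exists n => //; apply: (@le_trans _ _ (birkhoff_sum n (normalized A) z)%:E).
  by rewrite lee_fin.
by apply: ereal_sup_ubound; exists z.
Qed.

Lemma peierls_barrier_triangle A w x y : lipschitz_fun A ->
  (peierls_barrier A x w + peierls_barrier A w y <= peierls_barrier A x y)%E.
Proof.
move=> [K AK]; apply: leeD_EFin_lt => r s rxw swy.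
apply: peierls_barrier_ge => e N e0.
have e20 : 0 < e / 2 by rewrite divr_gt0.
(* The first segment is fixed before the second, whose precision depends on it; the length [N] is
   demanded of the second. *)
have [n [z1 [_ z1w xz1 rz1]]] := peierls_barrier_gt rxw 0 e20.
(* [K] may be zero or negative, hence the constant [|K| + 1]. *)
have K1 : 0 < `|K| + 1 by rewrite ltr_wpDl.
set D := birkhoff_sum n (normalized A) z1 - r.
have D0 : 0 < D by rewrite subr_gt0.
(* The first bound keeps the spliced point within [e] of [x]; the second makes the change in the
   first Birkhoff sum smaller than its slack [D] over [r]. *)
have t0 : 0 < Num.min (e / 2) (D / (`|K| + 1)).
  by rewrite lt_min e20 divr_gt0.
have [k [z2 [Nk z2y + sz2]]] := peierls_barrier_gt swy N t0.
rewrite lt_min => /andP[wz2e wz2D].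
exists (n + k)%N, (splice n z1 z2); split.
- exact: leq_trans Nk (leq_addl _ _).
- by rewrite addnC iterD iter_shift_splice.
- rewrite (splitr e); apply: le_lt_trans (metric_triangle _ z1 _) _.
  rewrite ltrD//; apply: le_lt_trans wz2e.
  apply: le_trans (mdist_agree (@spliceE _ _ n z1 z2)) _.
  rewrite iter_shift_splice z1w ler_piMl ?mdist_ge0//.
  by rewrite exprn_ile1 ?invr_ge0// invf_le1// ler1n.
- have fK a b : `|normalized A a - normalized A b| <= (`|K| + 1) * mdist a b.
    rewrite /normalized opprB addrA subrK.
    apply: le_trans (AK a b) _; rewrite ler_wpM2r ?mdist_ge0//.
    by rewrite ler_wpDr// ler_norm.
  have := birkhoff_sum_lipschitz (ltW K1) fK (@spliceE _ _ n z1 z2).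
  rewrite iter_shift_splice z1w birkhoff_sumD iter_shift_splice.
  move: wz2D; rewrite ltr_pdivlMr// mulrC => wz2D.
  rewrite ler_norml => /andP[_]; rewrite /D in wz2D *; lra.
Qed.

(** Calibration gives [normalized A z <= u (shift z) - u z] at every point, and this telescopes
    along the orbit. *)
Lemma birkhoff_sum_subaction A u n z : calibrated_subaction A u ->
  birkhoff_sum n (normalized A) z <= u (iter n shift z) - u z.
Proof.
move=> [_ cal]; elim: n => [|n IH].
  by rewrite /birkhoff_sum big_ord0 subrr.
have [_ /(_ (A (iter n shift z) + u (iter n shift z) - max_mean A))] :=
  cal (iter n.+1 shift z).
move=> /(_ (ex_intro2 _ _ (iter n shift z) erefl erefl)).
move: IH; rewrite /birkhoff_sum big_ord_recr/= /normalized; lra.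
Qed.

Lemma peierls_barrier_le A u x y : calibrated_subaction A u ->
  (peierls_barrier A x y <= (u y - u x)%:E)%E.
Proof.
move=> u_cal; apply: lee_EFin_lt => r rh; rewrite lee_fin.
apply/ler_addgt0Pr => e e0.
(* Orbit segments start only near [x]; continuity of [u] replaces [u z] by [u x] up to [e]. *)
have /cvgrPdist_lt/(_ e e0)/nbhs_ballP[t /= t0 ux] := u_cal.1 x.
have [n [z [_ zy xz rz]]] := peierls_barrier_gt rh 0 t0.
have /ux : ball x t z by rewrite ballEmdist.
rewrite /= ltr_norml => /andP[_].
have := birkhoff_sum_subaction n z u_cal; rewrite zy; lra.
Qed.

Lemma barrier_rel_peierls A u x y : calibrated_subaction A u ->
  barrier_rel A x y -> peierls_barrier A x y = (u y - u x)%:E.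
Proof.
move=> u_cal; rewrite /barrier_rel.
have := peierls_barrier_le x y u_cal; have := peierls_barrier_le y x u_cal.
(* A sum equal to [0] leaves only finite values, as [+oo + -oo] is [-oo]. *)
case: (peierls_barrier A x y) => [a| |]//; case: (peierls_barrier A y x) => //b.
rewrite !lee_fin => hb ha [ab]; congr (_%:E); lra.
Qed.

Lemma peierls_barrier_subaction_le A u x w y :
  lipschitz_fun A -> calibrated_subaction A u -> barrier_rel A x w ->
  (peierls_barrier A w y + (u w)%:E <= peierls_barrier A x y + (u x)%:E)%E.
Proof.
move=> A_lip u_cal xw; have := peierls_barrier_triangle w x y A_lip.
rewrite (barrier_rel_peierls u_cal xw) => xwy.
rewrite -leeBlDr//; apply: le_trans xwy.
by rewrite -addeA -EFinB addeC.
Qed.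

Lemma peierls_barrier_subaction_eq A u x w y :
  lipschitz_fun A -> calibrated_subaction A u -> barrier_rel A x w ->
  (peierls_barrier A x y + (u x)%:E = peierls_barrier A w y + (u w)%:E)%E.
Proof.
move=> A_lip u_cal xw; have wx : barrier_rel A w x by rewrite /barrier_rel addeC.
apply: le_anti; apply/andP; split.
  exact: peierls_barrier_subaction_le A_lip u_cal wx.
exact: peierls_barrier_subaction_le A_lip u_cal xw.
Qed.

End barrier.

Theorem theorem4p8 (R : realType) (d : nat) (A : full_shift R d -> R)
    (A_lip : lipschitz_fun A)
    (u : full_shift R d -> R) (u_cal : calibrated_subaction A u)
    (C : set (full_shift R d)) (C_irr : irreducible_components A C)
    (x z : full_shift R d) (Cx : C x) (Cz : C z) (y : full_shift R d) :
  (peierls_barrier A x y + (u x)%:E = peierls_barrier A z y + (u z)%:E)%E.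
Proof.
case: C_irr Cx Cz => w _ <- [_ wx] [_ wz].
(* Both sides equal the value at the representative [w] of the class [C]. *)
apply: etrans (peierls_barrier_subaction_eq y A_lip u_cal wz).
exact/esym/(peierls_barrier_subaction_eq y A_lip u_cal wx).
Qed.
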